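(* Let $t,\varepsilon>0$ and $n\in\mathbb N$. There exists a unique $(a_k)_{k=0}^{n-2}\in(0,1)^{n-1}$ satisfying $$a_{k+1}+a_{k-1}=\frac{k+\varepsilon}{t}\,\frac{2a_k}{1-a_k^2},\qquad k=0,\ldots,n-2,$$ with the boundary conditions $a_{-1}=a_{n-1}=1$.
   Context: The displayed recurrence is the discrete Painlevé II equation (d-PII). The boundary values $a_{-1}$ and $a_{n-1}$ are fixed equal to $1$, and the unknowns are $a_0,\ldots,a_{n-2}$. *)

(* Defs.v *)
From HB Require Import structures.
From mathcomp Require Import all_boot all_order all_algebra.
From mathcomp Require Import reals.

Set Implicit Arguments.
Unset Strict Implicit.
Unset Printing Implicit Defensive.

Import Order.TTheory GRing.Theory Num.Theory.
Local Open Scope ring_scope.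

(* The sequence indexed by int (so that the index -1 makes sense) with entries
   a_0, ..., a_(m-1) at the indices 0, ..., m-1 and value 1 at all other
   indices; d-PII below only reads the two outside values at -1 and m. *)
Definition extend1 (R : realType) (m : nat) (a : 'rV[R]_m) (k : int) : R :=
  match k with
  | Posz j => if insub j is Some i then a 0 i else 1
  | Negz _ => 1
  end.

(* Discrete Painleve II for k = 0, ..., m-1; it involves b_(-1), ..., b_m. *)
Definition dPII (R : realType) (t eps : R) (m : nat) (b : int -> R) : Prop :=
  forall k : nat, (k < m)%N ->
    b (k%:Z + 1) + b (k%:Z - 1) =
      (k%:R + eps) / t * ((2 * b k%:Z) / (1 - b k%:Z ^+ 2)).

(* Main.v *)
Require Import Defs.
From HB Require Import structures.
From mathcomp Require Import all_boot all_order all_algebra.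
From mathcomp Require Import classical_sets reals.
From mathcomp Require Import ring lra.

Set Implicit Arguments.
Unset Strict Implicit.
Unset Printing Implicit Defensive.

Import Order.TTheory GRing.Theory Num.Theory.
Local Open Scope ring_scope.

(** Write [f u = 2u / (1 - u^2)] and [c_k = (k + eps) / t > 0].  The equation
    reads [a_(k+1) + a_(k-1) = c_k f(a_k)], and [f] is an increasing bijection
    from [0 <= u < 1] onto [0 <= s] with inverse [g s = s / (1 + sqrt (1 + s^2))].
    A solution is thus a fixed point of the map sending [a] to the vector of
    the [g ((a_(k+1) + a_(k-1)) / c_k)].

    Existence ([exists_dPII_solution]).  That map is monotone on the complete
    lattice [[0, 1]^m], so it has a fixed point by Knaster and Tarski
    ([unit_cube_fixpoint]).  Its entries are below 1 because [g < 1]; they are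
    positive because the boundary value 1 at -1 makes [a_0] positive and each
    positive entry makes the next one positive.

    Uniqueness ([dPII_solution_le]).  As [f] is strictly convex and
    [f 0 = 0], it satisfies [f (l v) < l f v] for [0 < l < 1] ([dPII_rhs_scale]).
    Given solutions [a] and [b], let [l] be the least ratio [a_k / b_k].
    If [l < 1], then [l b <= a] holds everywhere, including at the boundary,
    where [l <= 1]; at the index [k] of the minimum this gives
    [c_k f(a_k) = c_k f(l b_k) < l c_k f(b_k) = l (b_(k+1) + b_(k-1))
    <= a_(k+1) + a_(k-1) = c_k f(a_k)], which is absurd.  So [b <= a], and by
    symmetry [a = b]. *)

(** * The nonlinearity and its inverse *)

Definition dPII_rhs (R : realType) (u : R) : R := 2 * u / (1 - u ^+ 2).

Definition dPII_rhs_inv (R : realType) (s : R) : R :=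
  s / (1 + Num.sqrt (1 + s ^+ 2)).

(** Scaling [v] down scales the numerator by [l] but strictly enlarges the
    denominator. *)
Lemma dPII_rhs_scale (R : realType) (l v : R) :
  0 < l < 1 -> 0 < v < 1 -> dPII_rhs (l * v) < l * dPII_rhs v.
Proof.
move=> /andP[l0 l1] /andP[v0 v1]; rewrite /dPII_rhs.
have lv1 : l * v < v by rewrite gtr_pMl.
have lv0 : 0 < l * v by rewrite mulr_gt0.
have dv : 0 < 1 - v ^+ 2 by nra.
have dlt : 1 - v ^+ 2 < 1 - (l * v) ^+ 2 by nra.
rewrite (mulrCA 2) -(mulrA l) ltr_pM2l // ltr_pM2l ?mulr_gt0 //.
by rewrite ltf_pV2 // posrE (lt_trans dv).
Qed.

Lemma dPII_rhs_lt (R : realType) (u v : R) :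
  0 <= u -> u < v -> v < 1 -> dPII_rhs u < dPII_rhs v.
Proof.
move=> u0 uv v1; rewrite /dPII_rhs.
have v0 : 0 < v by exact: le_lt_trans uv.
have dv : 0 < 1 - v ^+ 2 by nra.
have dvu : 1 - v ^+ 2 < 1 - u ^+ 2 by nra.
have du := lt_trans dv dvu.
apply: ltr_pM; rewrite ?mulr_ge0 ?invr_ge0 ?(ltW du) ?ltr_pM2l //.
by rewrite ltf_pV2.
Qed.

Lemma dPII_rhs_inv_ge0 (R : realType) (s : R) : 0 <= s -> 0 <= dPII_rhs_inv s.
Proof. by move=> s0; rewrite divr_ge0 // addr_ge0 ?sqrtr_ge0. Qed.

Lemma dPII_rhs_inv_gt0 (R : realType) (s : R) : 0 < s -> 0 < dPII_rhs_inv s.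
Proof. by move=> s0; rewrite divr_gt0 // ltr_pwDl ?sqrtr_ge0. Qed.

Lemma dPII_rhs_inv_lt1 (R : realType) (s : R) : dPII_rhs_inv s < 1.
Proof.
have r0 := sqrtr_ge0 (1 + s ^+ 2).
have r2 : Num.sqrt (1 + s ^+ 2) ^+ 2 = 1 + s ^+ 2.
  by rewrite sqr_sqrtr // addr_ge0 ?sqr_ge0.
by rewrite ltr_pdivrMr ?mul1r; nra.
Qed.

Lemma dPII_rhs_invK (R : realType) : cancel (@dPII_rhs_inv R) (@dPII_rhs R).
Proof.
move=> s; rewrite /dPII_rhs /dPII_rhs_inv.
have r0 := sqrtr_ge0 (1 + s ^+ 2).
have r2 : Num.sqrt (1 + s ^+ 2) ^+ 2 = 1 + s ^+ 2.
  by rewrite sqr_sqrtr // addr_ge0 ?sqr_ge0.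
move: (Num.sqrt _) r0 r2 => r r0 r2.
have r1 : 1 + r != 0 by rewrite gt_eqF // ltr_pwDl.
have -> : 1 - (s / (1 + r)) ^+ 2 = 2 / (1 + r).
  have -> : (s / (1 + r)) ^+ 2 = (r ^+ 2 - 1) / (1 + r) ^+ 2.
    by rewrite r2 expr_div_n addrAC subrr add0r.
  by field.
by field.
Qed.

Lemma dPII_rhs_inv_le (R : realType) (s s' : R) :
  0 <= s' -> s <= s' -> dPII_rhs_inv s <= dPII_rhs_inv s'.
Proof.
move=> s0 ss; rewrite leNgt; apply/negP => /dPII_rhs_lt.
move=> /(_ (dPII_rhs_inv_ge0 s0) (dPII_rhs_inv_lt1 s)).
by rewrite !dPII_rhs_invK ltNge ss.
Qed.

(** * A fixed point theorem on cubes *)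

(** Knaster and Tarski: the pointwise supremum of the [x] with [x <= F x] is a
    fixed point. *)
Lemma unit_cube_fixpoint (R : realType) (I : Type) (F : (I -> R) -> I -> R) :
    (forall x, (forall i, 0 <= x i <= 1) -> forall i, 0 <= F x i <= 1) ->
    (forall x y, (forall i, 0 <= x i <= 1) -> (forall i, 0 <= y i <= 1) ->
      (forall i, x i <= y i) -> forall i, F x i <= F y i) ->
  exists x, (forall i, 0 <= x i <= 1) /\ F x =1 x.
Proof.
move=> F01 Fmono.
pose sub (x : I -> R) := (forall i, 0 <= x i <= 1) /\ (forall i, x i <= F x i).
pose V i : set R := [set x i | x in sub]%classic.
have sub0 : sub (fun=> 0).
  have z01 (i : I) : 0 <= (0 : R) <= 1 by rewrite lexx ler01.
  by split=> // i; case/andP: (F01 (fun=> 0) z01 i).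
have Vub i : ubound (V i) 1 by move=> _ [x [x01 _] <-]; case/andP: (x01 i).
have leV x : sub x -> forall i, x i <= sup (V i).
  by move=> sx i; apply: ub_le_sup; [exists 1; apply: Vub|exists x].
have leVub i b : ubound (V i) b -> sup (V i) <= b.
  by apply: ge_sup; exists 0, (fun=> 0).
have s01 i : 0 <= sup (V i) <= 1.
  by rewrite (leV _ sub0) leVub.
have sF i : sup (V i) <= F (fun i => sup (V i)) i.
  apply: leVub => _ [x sx <-]; have [x01 xF] := sx.
  by apply: le_trans (xF i) _; apply: Fmono => // j; apply: leV.
exists (fun i => sup (V i)); split=> // i.
apply/le_anti; rewrite sF andbT; apply: (leV (F _)).
by split=> [|j]; [exact: F01|apply: Fmono => //; exact: F01].
Qed.

(** * Vectors extended by the boundary value *)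

Lemma extend1_ord (R : realType) (m : nat) (a : 'rV[R]_m) (i : 'I_m) :
  extend1 a (i : nat)%:Z = a 0 i.
Proof. by rewrite /extend1 valK. Qed.

Lemma extend1_size (R : realType) (m : nat) (a : 'rV[R]_m) :
  extend1 a m%:Z = 1.
Proof. by rewrite /extend1 insubF // ltnn. Qed.

(** Scaling by [l <= 1] is compatible with the boundary because [l * 1 <= 1];
    the case [l = 1] is monotonicity. *)
Lemma le_extend1 (R : realType) (m : nat) (l : R) (a b : 'rV[R]_m) :
  l <= 1 -> (forall i, l * b 0 i <= a 0 i) ->
  forall k, l * extend1 b k <= extend1 a k.
Proof.
move=> l1 ba [j|j] /=; last by rewrite mulr1.
by case: insub => [i|]; rewrite ?mulr1.
Qed.

Lemma extend1_ge0 (R : realType) (m : nat) (a : 'rV[R]_m) :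
  (forall i, 0 <= a 0 i) -> forall k, 0 <= extend1 a k.
Proof. by move=> a0 [j|j] //=; case: insub. Qed.

(** For [n = 0] the index is -1; for positive [n] it is the length [n.-1]. *)
Lemma extend1_boundary (R : realType) (n : nat) (a : 'rV[R]_n.-1) :
  extend1 a (n%:Z - 1) = 1.
Proof.
case: n a => [//|n] a.
by rewrite -predn_int // extend1_size.
Qed.

(** * Existence and uniqueness *)

Section Solutions.

Variables (R : realType) (t eps : R).
Hypotheses (t_gt0 : 0 < t) (eps_gt0 : 0 < eps).

Let c (k : nat) : R := (k%:R + eps) / t.

Let c_gt0 k : 0 < c k.
Proof. by rewrite divr_gt0 // ltr_wpDl. Qed.

(** Comparison at the index of the least ratio [a_k / b_k]; uniqueness follows
    by exchanging [a] and [b]. *)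
Lemma dPII_solution_le (m : nat) (a b : 'rV[R]_m) :
    (forall i, 0 < a 0 i < 1) -> (forall i, 0 < b 0 i < 1) ->
    dPII t eps m (extend1 a) -> dPII t eps m (extend1 b) ->
  forall i, b 0 i <= a 0 i.
Proof.
move=> a01 b01 ea eb i0.
have b0 i : 0 < b 0 i by case/andP: (b01 i).
have [k _ kmin] := @Order.TotalTheory.arg_minP _ _ _ i0 xpredT
  (fun i => a 0 i / b 0 i) isT.
set l := a 0 k / b 0 k in kmin.
have lb i : l * b 0 i <= a 0 i by rewrite -ler_pdivlMr // kmin.
have [l1|l1] := leP 1 l.
  by apply: le_trans (lb i0); rewrite ler_peMl // ltW.
have l0 : 0 < l by rewrite divr_gt0 //; case/andP: (a01 k).
have le_ext := le_extend1 (ltW l1) lb.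
have := ea k (ltn_ord k); have := eb k (ltn_ord k).
rewrite !extend1_ord -!/(dPII_rhs _) -!/(c k) => ebk eak.
have := @dPII_rhs_scale R l (b 0 k); rewrite l0 l1 => /(_ isT (b01 k)).
(* Here [l * b 0 k] is [a 0 k]. *)
rewrite {1}/l divfK ?gt_eqF // -(ltr_pM2l (c_gt0 k)) (mulrCA _ l) -ebk -eak mulrDr.
by rewrite ltNge lerD.
Qed.

(** Applying [dPII_rhs_inv] turns the equations into a fixed point problem for
    a monotone map.  Knaster and Tarski alone allow zero entries; the boundary
    value at -1 excludes them. *)
Lemma exists_dPII_solution (m : nat) :
  exists a : 'rV[R]_m, (forall i, 0 < a 0 i < 1) /\ dPII t eps m (extend1 a).
Proof.
pose nb (x : 'I_m -> R) (k : nat) :=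
  extend1 (\row_i x i) (k%:Z + 1) + extend1 (\row_i x i) (k%:Z - 1).
have nb_ge0 x k : (forall i, 0 <= x i <= 1) -> 0 <= nb x k / c k.
  move=> x01; have x0 i : 0 <= (\row_i x i) 0 i.
    by rewrite mxE; case/andP: (x01 i).
  by rewrite divr_ge0 ?(ltW (c_gt0 k)) // addr_ge0 // extend1_ge0.
have [||x [x01 xfix]] :=
    @unit_cube_fixpoint R 'I_m (fun x i => dPII_rhs_inv (nb x i / c i)).
- by move=> x x01 i; rewrite dPII_rhs_inv_ge0 ?nb_ge0 ?ltW ?dPII_rhs_inv_lt1.
- move=> x y x01 y01 xy i; apply: dPII_rhs_inv_le; first exact: nb_ge0.
  have le_ext k : extend1 (\row_i x i) k <= extend1 (\row_i y i) k.
    rewrite -[leLHS]mul1r; apply: le_extend1 => // j.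
    by rewrite mul1r !mxE.
  by rewrite ler_pM2r ?invr_gt0 // lerD.
have x_gt0 (k : nat) (km : (k < m)%N) : 0 < x (Ordinal km).
  have ext_ge0 : forall j, 0 <= extend1 (\row_i x i) j.
    by apply: extend1_ge0 => i; rewrite mxE; case/andP: (x01 i).
  (* The left neighbour of index 0 is the boundary value 1. *)
  elim: k km => [|k IHk] km; rewrite -xfix dPII_rhs_inv_gt0 // divr_gt0 //.
    by rewrite /nb ltr_wpDl.
  rewrite /nb ltr_wpDl // -predn_int //.
  by rewrite -[_.-1]/(val (Ordinal (ltnW km))) extend1_ord mxE.
exists (\row_i x i); split=> [i|k km].
  rewrite mxE -{2}xfix dPII_rhs_inv_lt1 andbT.
  by case: i => k km; apply: x_gt0.
rewrite -[k]/(val (Ordinal km)) extend1_ord mxE -/(dPII_rhs _) -/(c k).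
by rewrite -xfix dPII_rhs_invK mulrC divfK ?gt_eqF.
Qed.

End Solutions.

Theorem theorem2p1 (R : realType) (t eps : R) (n : nat)
    (t_gt0 : 0 < t) (eps_gt0 : 0 < eps) :
  exists! a : 'rV[R]_(n.-1),
    (forall i : 'I_(n.-1), 0 < a 0 i < 1) /\
    extend1 a (-1) = 1 /\ extend1 a (n%:Z - 1) = 1 /\
    dPII t eps n.-1 (extend1 a).
Proof.
have [a [a01 ea]] := exists_dPII_solution t_gt0 eps_gt0 n.-1.
exists a; split.
  by split=> //; split=> //; split=> //; apply: extend1_boundary.
move=> b [b01 [_ [_ eb]]]; apply/rowP => i; apply/le_anti.
by rewrite !(dPII_solution_le t_gt0 eps_gt0).
Qed.
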